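(* Let $X$ be a Tychonoff space which is a $k$-space. Then the free topological vector space $\mathbb{V}(X)$ is locally convex if and only if $X$ is a discrete countable space, that is, $\mathbb{V}(X)$ equals $\phi$ or $\mathbb{R}^n$ for some $n\in\mathbb{N}$.
   Context: All vector spaces are over $\mathbb{R}$; all topological spaces are Tychonoff (so topological vector spaces are Hausdorff). The free topological vector space over a Tychonoff space $X$ is a topological vector space $\mathbb{V}(X)$ together with a continuous map $i:X\to\mathbb{V}(X)$ such that for every continuous map $f$ from $X$ to a topological vector space $E$ there is a unique continuous linear operator $\bar f:\mathbb{V}(X)\to E$ with $f=\bar f\circ i$. $\phi:=\mathbb{V}(\mathbb{N})$ with $\mathbb{N}$ discrete (the inductive limit of the spaces $\mathbb{R}^n$). ''Countable'' includes finite. A (Hausdorff) space $X$ is a $k$-space if a subset $A\subseteq X$ is closed whenever $A\cap K$ is closed in $K$ for every compact $K\subseteq X$. ''Equals'' means up to isomorphism of topological vector spaces. *)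

(* Defs.v *)
From HB Require Import structures.
From mathcomp Require Import all_boot all_order all_algebra.
From mathcomp Require Import all_classical all_reals all_analysis.

Set Implicit Arguments.
Unset Strict Implicit.
Unset Printing Implicit Defensive.

Import Order.TTheory GRing.Theory Num.Theory.
Import numFieldTopology.Exports numFieldNormedType.Exports.

Local Open Scope classical_set_scope.
Local Open Scope ring_scope.

Definition tychonoff_space (X : topologicalType) : Prop :=
  hausdorff_space X /\ completely_regular_space X.

(* [subspace K] keeps the carrier of [X] and isolates the points outside [K];
   as [A `&` K] lies in [K], closedness there is relative closedness in [K]. *)
Definition k_space (X : topologicalType) : Prop :=
  forall A : set X,
    (forall K : set X, compact K -> closed (A `&` K : set (subspace K))) ->
    closed A.

Definition discrete_space (X : topologicalType) : Prop :=
  forall A : set X, open A.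

(* A topological vector space is a [topologicalLmodType]; the library's
   [tvsType] is not used because it has local convexity built in. The condition
   below is the one that [tvsType] adds. *)
Definition locally_convex_tvs (R : realType) (E : topologicalLmodType R) :
  Prop :=
  exists2 B : set_system E, (forall b, b \in B -> convex_set b) & basis B.

(* Topological vector spaces are Hausdorff by convention, both for the free
   space and for the targets of the universal property. *)
Definition is_free_tvs (R : realType) (X : topologicalType)
    (V : topologicalLmodType R) (i : X -> V) : Prop :=
  [/\ hausdorff_space V, continuous i &
    forall (E : topologicalLmodType R) (f : X -> E),
      hausdorff_space E -> continuous f ->
      exists fbar : {linear V -> E},
        [/\ continuous fbar, f = fbar \o i &
          forall g : {linear V -> E},
            continuous g -> f = g \o i -> g =1 fbar]].

Definition tvs_isomorphic (R : realType) (E F : topologicalLmodType R) : Prop :=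
  exists (f : {linear E -> F}) (g : {linear F -> E}),
    [/\ cancel f g, cancel g f, continuous f & continuous g].

(* "[V] equals phi": the free space over the discrete space [nat] is only
   determined up to isomorphism, so any of its models will do. *)
Definition equals_phi (R : realType) (V : topologicalLmodType R) : Prop :=
  exists (Phi : topologicalLmodType R) (j : nat -> Phi),
    is_free_tvs j /\ tvs_isomorphic V Phi.

Definition equals_Rn (R : realType) (V : topologicalLmodType R) (n : nat) :
  Prop :=
  tvs_isomorphic V 'rV[R]_n.

(* Main.v *)
From HB Require Import structures.
Require Import Defs.
From mathcomp Require Import all_boot all_order all_algebra finmap.
From mathcomp Require Import all_classical all_reals all_analysis.
From mathcomp Require Import lra.

Set Implicit Arguments.
Unset Strict Implicit.
Unset Printing Implicit Defensive.

Import Order.TTheory GRing.Theory Num.Theory.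
Import numFieldTopology.Exports numFieldNormedType.Exports.

Local Open Scope classical_set_scope.
Local Open Scope ring_scope.
Local Open Scope convex_scope.

(** The topology of the free space is the finest vector topology making [i]
    continuous, and its universal property turns any continuous map from [X] to
    a topological vector space [E] into a test of that topology. Two kinds of
    [E] suffice here, both carried by the space [formal R X] of finitely
    supported functions on an index set, that is, of formal linear combinations
    of its points.

    For the sufficiency of the two conditions, [E] carries all the weighted l1
    norms, the finest locally convex topology. When [X] is countable, weights
    can be chosen large enough to absorb any neighborhood of 0 of any
    topological vector space, locally convex or not, so every linear map out of
    [E] is continuous ([lin_ext_l1_continuous]). Hence, if [X] is moreover
    discrete, the free space is a retract of [E] and inherits its local
    convexity.

    For their necessity, [E] carries the F-norm [f |-> \sum_x sqrt |f x|], for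
    which averaging makes vectors larger: if [n] vectors of a convex set are
    mapped to multiples of distinct basis vectors by factors of modulus at least
    [r], their mean has F-norm at least [sqrt (n * r)]. A convex set that is
    mapped into the unit ball therefore satisfies [n * r < 1]
    ([convex_root_norm_bound]). This is used twice. If [X] is discrete, send each
    point to its basis vector; a convex neighborhood of 0 contains [i x / k] for
    some [k > 0] depending on [x], the bound allows fewer than [k] points for
    each [k], and so [X] is countable. If [K] is an infinite compact subset of
    [X], complete regularity yields continuous functions [h n] with disjoint
    supports and value 1 at points [y n] of [K]; the map [z |-> h n z / sqrt
    (n + 1)] times the [n]-th basis vector, for the only [n] with [h n z != 0],
    is continuous because the coefficients tend to 0. A neighborhood of 0
    contains [t * i x] for all [x] in [K] and one [t > 0], since [K] is compact,
    and then the bound says that [n * t / sqrt n < 1] for every [n], which is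
    absurd. So local convexity makes all compact subsets of [X] finite, which in
    a Hausdorff k-space forces discreteness.

    Finally, a countable discrete space is in bijection with [nat] or with an
    initial segment of it, which gives the two models of the free space;
    conversely both models are locally convex, and the first equivalence then
    gives back the conditions on [X]. *)

(** * Vector topologies given by F-seminorms *)

(** The directedness makes the balls of the members a base of neighborhoods, with
    no finite intersections. Homogeneity is weakened to monotonicity on the unit
    ball of scalars and continuity along lines: this is what allows topologies
    that are not locally convex. Positivity and [q 0 = 0] follow. *)
Record Fseminorms (R : realType) (E : lmodType R) := {
  Fset :> (E -> R) -> Prop ;
  Fset_neq0 : exists q, Fset q ;
  Fset_directed : forall p q, Fset p -> Fset q ->
    exists2 r, Fset r & forall x, p x <= r x /\ q x <= r x ;
  FseminormD : forall q, Fset q -> forall x y, q (x + y) <= q x + q y ;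
  FseminormZ : forall q, Fset q -> forall (t : R) x, `|t| <= 1 -> q (t *: x) <= q x ;
  Fseminorm_absorbing : forall q, Fset q -> forall x e, 0 < e ->
    exists2 d : R, 0 < d & q (d *: x) < e }.

(** An alias of [E], so that the topology of [Q] does not clash with another one
    on the same carrier. *)
Definition Fspace (R : realType) (E : lmodType R) (Q : Fseminorms E) : Type := E.

Section FspaceTopology.
Context {R : realType} {E : lmodType R} {Q : Fseminorms E}.
Implicit Types (q : E -> R) (x y : E).

Lemma Fseminorm_ge0 q x : Q q -> 0 <= q x.
Proof.
move=> Qq.
have q0 : 0 <= q 0.
  by have := FseminormD Qq 0 0; rewrite addr0 -subr_ge0 addrK.
apply: le_trans q0 _; rewrite -[in leLHS](scale0r x).
by apply: (FseminormZ Qq); rewrite normr0.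
Qed.

Lemma Fseminorm0 q : Q q -> q 0 = 0.
Proof.
move=> Qq; apply/eqP; rewrite eq_le Fseminorm_ge0// andbT.
apply/ler_addgt0Pl => e e0.
have [d d0] := Fseminorm_absorbing Qq 0 e0.
by rewrite scaler0 addr0 => /ltW.
Qed.

Lemma FseminormN q x : Q q -> q (- x) = q x.
Proof.
move=> Qq.
have le_opp y : q (- y) <= q y.
  by rewrite -scaleN1r; apply: (FseminormZ Qq); rewrite normrN normr1.
by apply/eqP; rewrite eq_le le_opp -{1}(opprK x) le_opp.
Qed.

Lemma FseminormBC q x y : Q q -> q (x - y) = q (y - x).
Proof. by move=> Qq; rewrite -opprB FseminormN. Qed.

Lemma Fseminorm_triangle q x y z : Q q -> q (x - z) <= q (x - y) + q (y - z).
Proof. by move=> Qq; apply: le_trans (FseminormD Qq _ _); rewrite addrA subrK. Qed.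

Definition Fball q (e : R) x : set E := [set y | q (y - x) < e].

HB.instance Definition _ := GRing.Lmodule.on (Fspace Q).

Definition Fnbhs (x : Fspace Q) : set_system (Fspace Q) :=
  fun A => exists q, exists2 e, Q q /\ 0 < e & Fball q e x `<=` A.

HB.instance Definition _ := hasNbhs.Build (Fspace Q) Fnbhs.

Let Fnbhs_filter (x : Fspace Q) : ProperFilter (nbhs x).
Proof.
apply: Build_ProperFilter_ex => [A [q [e [Qq e0] sA]]|].
  by exists x; apply: sA; rewrite /Fball/= subrr Fseminorm0.
split.
- by have [q Qq] := Fset_neq0 Q; exists q, 1.
- move=> A B [p [e [Qp e0] sA]] [q [d [Qq d0] sB]].
  have [r Qr le_r] := Fset_directed Qp Qq.
  exists r, (Num.min e d); first by split => //; rewrite lt_min e0.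
  move=> y; rewrite /Fball/= lt_min => /andP[ye yd].
  have [le1 le2] := le_r (y - x).
  by split; [apply: sA; apply: le_lt_trans ye | apply: sB; apply: le_lt_trans yd].
- by move=> A B AB [q [e Qe sA]]; exists q, e => //; apply: subset_trans AB.
Qed.

Let Fnbhs_singleton (x : Fspace Q) (A : set (Fspace Q)) : nbhs x A -> A x.
Proof.
by move=> [q [e [Qq e0] sA]]; apply: sA; rewrite /Fball/= subrr Fseminorm0.
Qed.

Let Fnbhs_nbhs (x : Fspace Q) (A : set (Fspace Q)) :
  nbhs x A -> nbhs x (nbhs^~ A).
Proof.
move=> [q [e [Qq e0] sA]]; exists q, e => // y xy.
exists q, (e - q (y - x)); first by split=> //; rewrite subr_gt0.
move=> z; rewrite /Fball/= ltrBrDr => yz; apply: sA.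
exact: le_lt_trans (Fseminorm_triangle _ y _ Qq) _.
Qed.

HB.instance Definition _ := Nbhs_isNbhsTopological.Build (Fspace Q)
  Fnbhs_filter Fnbhs_singleton Fnbhs_nbhs.

Lemma nbhs_Fball q e (x : Fspace Q) : Q q -> 0 < e -> nbhs x (Fball q e x).
Proof. by move=> Qq e0; exists q, e. Qed.

Lemma open_Fball q e (x : Fspace Q) : Q q -> open (Fball q e x : set (Fspace Q)).
Proof.
move=> Qq; rewrite openE => y xy.
exists q, (e - q (y - x)); first by split=> //; rewrite subr_gt0.
move=> z; rewrite /Fball/= ltrBrDr => yz.
exact: le_lt_trans (Fseminorm_triangle _ y _ Qq) _.
Qed.

Let Fadd_continuous : continuous (fun z : Fspace Q * Fspace Q => z.1 + z.2).
Proof.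
move=> [x y] A /= [q [e [Qq e0] sA]].
exists (Fball q (e / 2) x, Fball q (e / 2) y) => /=.
  by split; apply: nbhs_Fball => //; rewrite divr_gt0.
move=> [x' y'] [/= xx' yy']; apply: sA; rewrite /Fball/= opprD addrACA.
by apply: le_lt_trans (FseminormD Qq _ _) _; rewrite [ltRHS]splitr ltrD.
Qed.

Lemma FseminormMn q x n : Q q -> q (x *+ n) <= q x *+ n.
Proof.
move=> Qq; elim: n => [|n IH]; first by rewrite !mulr0n Fseminorm0.
by rewrite !mulrS; apply: le_trans (FseminormD Qq _ _) _; rewrite lerD2l.
Qed.

Lemma FseminormZ_le q (s t : R) x : Q q -> `|s| <= `|t| -> q (s *: x) <= q (t *: x).
Proof.
move=> Qq st; have [t0|t0] := eqVneq t 0.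
  by move: st; rewrite t0 normr0 normr_le0 => /eqP->.
rewrite -[s](divfK t0) -scalerA; apply: (FseminormZ Qq).
by rewrite normrM normfV ler_pdivrMr ?normr_gt0// mul1r.
Qed.

Let Fscale_continuous : continuous (fun z : R^o * Fspace Q => z.1 *: z.2).
Proof.
move=> [t x] A /= [q [e [Qq e0] sA]].
have [d d0 xd] := Fseminorm_absorbing Qq x (divr_gt0 e0 (ltr0n R 2) : 0 < e / 2).
(* An integer bound on the scalars near [t] turns scaling into repeated
   addition, the only way to control [q] on large multiples. *)
pose n := Num.truncn (`|t| + d).
have n_gt : `|t| + d < n.+1%:R by exact: truncnS_gt.
exists (ball t d, Fball q (e / 2 / n.+1%:R) x) => /=.
  split; first exact: nbhsx_ballx.
  by apply: nbhs_Fball => //; rewrite !divr_gt0.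
move=> [s y] [/=]; rewrite -ball_normE/= => st xy; apply: sA; rewrite /Fball/=.
have -> : s *: y - t *: x = s *: (y - x) + (s - t) *: x.
  by rewrite scalerBr scalerBl addrA subrK.
apply: le_lt_trans (FseminormD Qq _ _) _; rewrite [ltRHS]splitr ltrD//.
- have : q (s *: (y - x)) <= q (n.+1%:R *: (y - x)).
    apply: (FseminormZ_le _ Qq); rewrite normr_nat; apply: le_trans (ltW n_gt).
    by rewrite -[s](subrK t) addrC (le_trans (ler_normD _ _))// lerD2l distrC ltW.
  move=> /le_lt_trans; apply; rewrite scaler_nat.
  apply: le_lt_trans (FseminormMn _ _ Qq) _.
  by rewrite -[ltLHS]mulr_natr -ltr_pdivlMr.
- apply: le_lt_trans xd; apply: (FseminormZ_le _ Qq).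
  by rewrite (gtr0_norm d0) distrC ltW.
Qed.

HB.instance Definition _ :=
  PreTopologicalNmodule_isTopologicalNmodule.Build (Fspace Q) Fadd_continuous.
HB.instance Definition _ :=
  TopologicalNmodule_isTopologicalLmodule.Build R (Fspace Q) Fscale_continuous.

Lemma Fspace_hausdorff :
  (forall x, (forall q, Q q -> q x = 0) -> x = 0) -> hausdorff_space (Fspace Q).
Proof.
move=> sep x y xy; apply/eqP; rewrite -subr_eq0; apply/eqP/sep => q Qq.
apply/eqP; rewrite eq_le Fseminorm_ge0// andbT; apply/ler_addgt0Pl => e e0.
have e2 : 0 < e / 2 by rewrite divr_gt0.
have [z [xz yz]] := xy _ _ (nbhs_Fball x Qq e2) (nbhs_Fball y Qq e2).
rewrite addr0 [leRHS]splitr; apply: le_trans (Fseminorm_triangle _ z _ Qq) _.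
by rewrite lerD// ltW// FseminormBC.
Qed.

Lemma Fspace_locally_convex :
  (forall q, Q q -> forall (t : R) x, 0 <= t -> q (t *: x) <= t * q x) ->
  locally_convex_tvs (Fspace Q).
Proof.
move=> homQ.
exists [set b | exists q e (x : Fspace Q), Q q /\ b = Fball q e x].
  move=> b /[!inE] -[q [e [x [Qq ->]]]]; apply/convex_setW.
  move=> y z /[!inE]; rewrite /Fball/= => xy xz k k0 k1.
  suff : q (k%:num *: (y - x : E) + (1 - k%:num) *: (z - x : E)) < e.
    rewrite !scalerBr addrACA -opprD -scalerDl [k%:num + _]addrC subrK scale1r.
    by rewrite inE.
  have k1' : 0 < 1 - k%:num by rewrite subr_gt0.
  apply: le_lt_trans (FseminormD Qq _ _) _.
  apply: (@le_lt_trans _ _ (k%:num * q (y - x) + (1 - k%:num) * q (z - x))).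
    by rewrite lerD// homQ// ltW.
  have -> : e = k%:num * e + (1 - k%:num) * e.
    by rewrite -mulrDl [k%:num + _]addrC subrK mul1r.
  by rewrite ltrD// ltr_pM2l.
split=> [b [q [e [x [Qq ->]]]]|x A [q [e [Qq e0] sA]]]; first exact: open_Fball.
exists (Fball q e x) => //=; split; last by rewrite /Fball/= subrr Fseminorm0.
by exists q, e, x.
Qed.

End FspaceTopology.

(** * Formal linear combinations *)

Section FinitelySupported.
Context (R : realType) (X : choiceType).

Definition fsupported : {pred X -> R^o} :=
  [pred f | `[< exists A : {fset X}, forall x, x \notin A -> f x = 0 >]].

Lemma fsupported_submod_closed : submod_closed fsupported.
Proof.
split=> [|t f g /asboolP[A fA] /asboolP[B gB]]; first by apply/asboolP; exists fset0.
apply/asboolP; exists (A `|` B)%fset => x; rewrite inE negb_or => /andP[xA xB].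
by rewrite !fctE /= fA// gB// scaler0 addr0.
Qed.

HB.instance Definition _ :=
  GRing.isSubmodClosed.Build R (X -> R^o) fsupported fsupported_submod_closed.

Record formal := Formal {
  formal_val :> X -> R^o ; formal_valP : formal_val \in fsupported }.

HB.instance Definition _ := [isSub for formal_val].
HB.instance Definition _ := [Choice of formal by <:].
HB.instance Definition _ := [SubChoice_isSubLmodule of formal by <:].

Implicit Types (f g : formal) (x : X) (t : R).

Lemma formalP f g : (forall x, f x = g x) -> f = g.
Proof. by move=> fg; apply/val_inj/funext. Qed.

Lemma formalDE f g x : (f + g) x = f x + g x. Proof. by []. Qed.
Lemma formalZE t f x : (t *: f) x = t * f x. Proof. by []. Qed.

Lemma formal_sumE (I : Type) (r : seq I) (F : I -> formal) x :
  (\sum_(j <- r) F j) x = \sum_(j <- r) F j x.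
Proof. by elim/big_rec2: _ => // j y f _ <-. Qed.

Lemma formal_supp f : exists A : {fset X}, forall x, x \notin A -> f x = 0.
Proof. by apply/asboolP; exact: formal_valP. Qed.

Fact delta_fsupported x : (fun y => (y == x)%:R) \in fsupported.
Proof.
apply/asboolP; exists [fset x]%fset => y.
by rewrite inE => /negbTE ->.
Qed.

Definition delta x : formal := Formal (delta_fsupported x).

Lemma deltaE x y : delta x y = (y == x)%:R. Proof. by []. Qed.

(** A sum with finite support over the whole index set may be taken over any
    finite set that contains the support; this is how sums for several vectors
    are brought to a common range. *)
Lemma formal_sum_fset (M : zmodType) f (A : {fset X}) (F : X -> R -> M) :
    (forall x, F x 0 = 0) -> (forall x, x \notin A -> f x = 0) ->
  \sum_(x \in [set: X]) F x (f x) = \sum_(x <- A) F x (f x).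
Proof. by move=> F0 fA; apply: fsbigTE => x /fA ->. Qed.

Definition lin_ext (V : lmodType R) (g : X -> V) (f : formal) : V :=
  \sum_(x \in [set: X]) (f x : R) *: g x.

Section LinExt.
Context (V : lmodType R) (g : X -> V).

Lemma lin_ext_fset f (A : {fset X}) : (forall x, x \notin A -> f x = 0) ->
  lin_ext g f = \sum_(x <- A) (f x : R) *: g x.
Proof.
move=> fA; rewrite /lin_ext (formal_sum_fset (F := fun x r => r *: g x) _ fA)//.
by move=> x; rewrite scale0r.
Qed.

Lemma lin_ext_is_linear : linear (lin_ext g).
Proof.
move=> t f h; have [A fA] := formal_supp f; have [B hB] := formal_supp h.
have outAB x : x \notin (A `|` B)%fset -> f x = 0 /\ h x = 0.
  by rewrite inE negb_or => /andP[/fA -> /hB ->].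
rewrite !(lin_ext_fset (A := (A `|` B)%fset)); [|by move=> x /outAB[? ?] //..|].
  rewrite scaler_sumr -big_split; apply: eq_bigr => x _.
  by rewrite formalDE formalZE scalerDl scalerA.
by move=> x /outAB[fx hx]; rewrite formalDE formalZE fx hx mulr0 addr0.
Qed.

HB.instance Definition _ :=
  GRing.isLinear.Build R formal V *:%R (lin_ext g) lin_ext_is_linear.

Lemma lin_ext_delta x : lin_ext g (delta x) = g x.
Proof.
rewrite (lin_ext_fset (A := [fset x]%fset)).
  by rewrite big_seq_fset1 deltaE eqxx scale1r.
by move=> y; rewrite inE deltaE => /negbTE ->.
Qed.

End LinExt.

(** * F-norms on formal linear combinations *)

Section Weighted.
Variable psi : R -> R.

(** With [psi] the identity this is a weighted l1 norm; with [psi] the square root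
    and weight 1 it is the F-norm of l^(1/2). *)
Definition wnorm (w : X -> R) (f : formal) : R :=
  \sum_(x \in [set: X]) w x * psi `|f x : R|.

Hypothesis psi0 : psi 0 = 0.
Hypothesis psi_ge0 : forall r : R, 0 <= r -> 0 <= psi r.
Hypothesis psi_mono : forall r s : R, 0 <= r -> r <= s -> psi r <= psi s.
Hypothesis psiD : forall r s : R, 0 <= r -> 0 <= s -> psi (r + s) <= psi r + psi s.
Hypothesis psi_continuous : {for 0, continuous psi}.

Lemma wnorm_fset w f (A : {fset X}) : (forall x, x \notin A -> f x = 0) ->
  wnorm w f = \sum_(x <- A) w x * psi `|f x : R|.
Proof.
move=> fA.
rewrite /wnorm (formal_sum_fset (F := fun x r => w x * psi `|r|) _ fA)// => x.
by rewrite normr0 psi0 mulr0.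
Qed.

Lemma wnorm_delta w t x : wnorm w (t *: delta x) = w x * psi `|t|.
Proof.
rewrite (@wnorm_fset _ _ [fset x]%fset).
  by rewrite big_seq_fset1 formalZE deltaE eqxx mulr1.
by move=> y; rewrite inE formalZE deltaE => /negbTE ->; rewrite mulr0.
Qed.

Lemma wnorm_ge_sum w f (s : seq X) : (forall x, (0 : R) <= w x) -> uniq s ->
  \sum_(x <- s) w x * psi `|f x : R| <= wnorm w f.
Proof.
move=> w0 us; have [A fA] := formal_supp f.
pose B := (A `|` [fset x in s])%fset.
rewrite (@wnorm_fset _ _ B); last by move=> x; rewrite inE negb_or => /andP[/fA].
rewrite [leRHS](bigID [pred x | x \in s])/= -[X in X + _]big_filter.
rewrite (@perm_big _ _ _ _ [seq x <- B | x \in s] s)/=; last first.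
  apply: uniq_perm => //; first by rewrite filter_uniq.
  by move=> x; rewrite mem_filter !inE; case: (x \in s); rewrite ?orbT.
by rewrite lerDl sumr_ge0// => x _; rewrite mulr_ge0// psi_ge0.
Qed.

Lemma wnorm_ge w f x :
  (forall x, (0 : R) <= w x) -> w x * psi `|f x : R| <= wnorm w f.
Proof.
by move=> w0; have := wnorm_ge_sum f w0 (_ : uniq [:: x]); rewrite big_seq1; apply.
Qed.

Lemma wnormD w f g :
  (forall x, (0 : R) <= w x) -> wnorm w (f + g) <= wnorm w f + wnorm w g.
Proof.
move=> w0; have [A fA] := formal_supp f; have [B gB] := formal_supp g.
have outAB x : x \notin (A `|` B)%fset -> f x = 0 /\ g x = 0.
  by rewrite inE negb_or => /andP[/fA -> /gB ->].
rewrite !(@wnorm_fset _ _ (A `|` B)%fset); [|by move=> x /outAB[? ?] //..|].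
  rewrite -big_split; apply: ler_sum => x _ /=.
  rewrite -mulrDr; apply: ler_wpM2l => //; apply: le_trans (psiD _ _) => //.
  by apply: psi_mono => //; exact: ler_normD.
by move=> x /outAB[fx gx]; rewrite formalDE fx gx addr0.
Qed.

Lemma wnormZ_le w t f :
  (forall x, (0 : R) <= w x) -> `|t| <= 1 -> wnorm w (t *: f) <= wnorm w f.
Proof.
move=> w0 t1; have [A fA] := formal_supp f.
rewrite !(@wnorm_fset _ _ A)//; last by move=> x /fA fx; rewrite formalZE fx mulr0.
apply: ler_sum => x _; apply: ler_wpM2l => //; apply: psi_mono => //.
by rewrite formalZE normrM ler_piMl.
Qed.

Lemma wnorm_le w v f : (forall x, (w x : R) <= v x) -> wnorm w f <= wnorm v f.
Proof.
move=> wv; have [A fA] := formal_supp f; rewrite !(@wnorm_fset _ _ A)//.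
by apply: ler_sum => x _; apply: ler_wpM2r => //; exact: psi_ge0.
Qed.

Lemma wnorm_absorbing w f e : 0 < e -> exists2 d : R, 0 < d & wnorm w (d *: f) < e.
Proof.
move=> e0; have [A fA] := formal_supp f.
have normE (d : R) : wnorm w (d *: f) = \sum_(x <- A) w x * psi `|d * f x : R|.
  by rewrite (@wnorm_fset _ _ A)// => x /fA fx; rewrite formalZE fx mulr0.
have : (\sum_(x <- A) w x * psi `|d * f x : R|) @[d --> (0 : R)] -->
    (\sum_(x <- A) w x * 0 : R).
  apply: cvg_big => [|x _]; first exact: add_continuous.
  apply: cvgM; first exact: cvg_cst.
  apply: (@cvg_comp _ _ _ (fun d : R => `|d * f x|) psi _ (nbhs (0 : R))); last first.
    by have := psi_continuous; rewrite /prop_for /continuous_at psi0.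
  have : `|d * f x| @[d --> (0 : R)] --> `|0 * f x : R|.
    by apply: cvg_norm; apply: cvgM; [exact: cvg_id|exact: cvg_cst].
  by rewrite mul0r normr0.
rewrite big1 => [|x _]; last by rewrite mulr0.
move=> /cvgrPdist_lt /(_ e e0) /nbhs_ballP[r /= r0 near0].
exists (r / 2); first by rewrite divr_gt0.
rewrite normE; have := near0 (r / 2); rewrite -ball_normE/= !sub0r !normrN.
rewrite gtr0_norm ?divr_gt0// gtr_pMr// invf_lt1// ltr1n => /(_ isT).
by apply: le_lt_trans; exact: ler_norm.
Qed.

End Weighted.
End FinitelySupported.

Section FsSystem.
Context (R : realType) (X : choiceType) (psi : R -> R).
Hypothesis psi0 : psi 0 = 0.
Hypothesis psi_ge0 : forall r : R, 0 <= r -> 0 <= psi r.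
Hypothesis psi_mono : forall r s : R, 0 <= r -> r <= s -> psi r <= psi s.
Hypothesis psiD : forall r s : R, 0 <= r -> 0 <= s -> psi (r + s) <= psi r + psi s.
Hypothesis psi_continuous : {for 0, continuous psi}.

Variable W : set (X -> R).
Hypothesis W1 : W (cst 1).
Hypothesis W_ge0 : forall w, W w -> forall x, (0 : R) <= w x.
Hypothesis W_directed : forall w v, W w -> W v ->
  exists2 u, W u & forall x, ((w x : R) <= u x) /\ ((v x : R) <= u x).

(** The weight 1 is required in [W] so that the topology is Hausdorff. *)
Program Definition wnorm_system : Fseminorms (formal R X) := {|
  Fset := fun q => exists2 w, W w & q = wnorm psi w |}.
Next Obligation. by exists (wnorm psi (cst 1)), (cst 1). Qed.
Next Obligation.
move=> _ _ [w Ww ->] [v Wv ->]; have [u Wu le_u] := W_directed Ww Wv.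
exists (wnorm psi u); first by exists u.
by move=> f; split; apply: wnorm_le => // x; have [] := le_u x.
Qed.
Next Obligation. by move=> _ [w Ww ->] f g; apply: wnormD => //; exact: W_ge0. Qed.
Next Obligation.
by move=> _ [w Ww ->] t f t1; apply: wnormZ_le => //; exact: W_ge0.
Qed.
Next Obligation. by move=> _ [w Ww ->] f e e0; exact: wnorm_absorbing. Qed.

Hypothesis psi_eq0 : forall r : R, 0 <= r -> psi r = 0 -> r = 0.

Lemma wnorm_system_hausdorff : hausdorff_space (Fspace wnorm_system).
Proof.
apply: Fspace_hausdorff => f f0; apply: formalP => x.
have f10 : wnorm psi (cst 1) f = 0 by apply: f0; exists (cst 1).
have := wnorm_ge psi0 psi_ge0 f x (fun x => ler01 : (0 : R) <= cst 1 x).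
rewrite f10 mul1r => le0; apply/eqP; rewrite -normr_eq0; apply/eqP.
by apply: psi_eq0 => //; apply/eqP; rewrite eq_le le0 psi_ge0.
Qed.

End FsSystem.

Section Spaces.
Context (R : realType) (X : choiceType).

Lemma sqrt_subadd (r s : R) : 0 <= r -> 0 <= s ->
  Num.sqrt (r + s) <= Num.sqrt r + Num.sqrt s.
Proof.
move=> r0 s0; rewrite -(ler_pXn2r (n := 2))// ?nnegrE ?addr_ge0 ?sqrtr_ge0//.
rewrite sqrrD !sqr_sqrtr ?addr_ge0// addrAC lerDl mulrn_wge0//.
Qed.

(** The topology of l^(1/2), the standard space that is not locally convex. *)
Definition root_system : Fseminorms (formal R X).
Proof.
apply: (@wnorm_system R X Num.sqrt _ _ _ _ _ [set cst 1]).
- exact: sqrtr0.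
- by move=> r _; exact: sqrtr_ge0.
- by move=> r s _; exact: ler_wsqrtr.
- exact: sqrt_subadd.
- exact: sqrt_continuous.
- by [].
- by move=> _ -> x /=.
- by move=> _ _ -> ->; exists (cst 1).
Defined.

(** All weights are allowed, which gives the finest locally convex topology. *)
Definition l1_system : Fseminorms (formal R X).
Proof.
apply: (@wnorm_system R X idfun _ _ _ _ _ [set w | forall x, (0 : R) <= w x]).
- by [].
- by [].
- by [].
- by [].
- exact: cvg_id.
- by move=> x /=.
- by [].
- move=> w v w0 v0; exists (fun x => Num.max (w x) (v x)) => /= x.
    by rewrite le_max w0.
  by rewrite !le_max !lexx orbT.
Defined.

Lemma root_hausdorff : hausdorff_space (Fspace root_system).
Proof.
apply: wnorm_system_hausdorff => r r0 /eqP.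
by rewrite sqrtr_eq0 => r0'; apply/eqP; rewrite eq_le r0' r0.
Qed.

Lemma l1_hausdorff : hausdorff_space (Fspace l1_system).
Proof. exact: wnorm_system_hausdorff. Qed.

Lemma l1_locally_convex : locally_convex_tvs (Fspace l1_system).
Proof.
apply: Fspace_locally_convex => _ [w w0 ->] t f t0.
have [A fA] := formal_supp f.
rewrite !(@wnorm_fset _ _ idfun _ _ _ A)//; last first.
  by move=> x /fA fx; rewrite formalZE fx mulr0.
rewrite mulr_sumr ler_sum// => x _; rewrite formalZE normrM (ger0_norm t0)/=.
by rewrite mulrCA.
Qed.

End Spaces.

(** * Continuity and convexity in topological vector spaces *)

Section Tvs.
Context {R : realType}.
Implicit Types E F V : topologicalLmodType R.

Lemma nbhs_add E (x y : E) (A : set E) : nbhs (x + y) A ->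
  exists B C, [/\ nbhs x B, nbhs y C & forall b c, B b -> C c -> A (b + c)].
Proof.
move=> /(@add_continuous E (x, y))[[B C] /= [xB yC] sA].
by exists B, C; split => // b c Bb Cc; exact: (sA (b, c)).
Qed.

Lemma nbhs_scale E (t : R) (x : E) (A : set E) : nbhs (t *: x) A ->
  exists2 e : R, 0 < e & exists2 B, nbhs x B &
    forall s y, `|s - t| < e -> B y -> A (s *: y).
Proof.
move=> /(@scale_continuous R E (t, x))[[B C] /= [/nbhs_ballP[e e0 tB] xC] sA].
exists e => //; exists C => // s y st Cy; apply: (sA (s, y)); split => //=.
by apply: tB; rewrite -ball_normE/= distrC.
Qed.

Lemma linear_continuous_at0 E F (f : {linear E -> F}) :
  (forall A, nbhs 0 A -> nbhs 0 (f @^-1` A)) -> continuous f.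
Proof.
move=> f0 x A; rewrite -[f x]addr0 => /nbhs_add[B [C [Bfx C0 sA]]].
have : nbhs (x - x) (f @^-1` C) by rewrite subrr; exact: f0.
move=> /nbhs_add[D [G [Dx Gx sfC]]].
apply: filterS Dx => y Dy; rewrite /= -[y](subrK x) addrC linearD.
apply: sA; first exact: nbhs_singleton.
by apply: sfC => //; exact: nbhs_singleton.
Qed.

Lemma continuous_preimage E F (f : E -> F) (x : E) (A : set F) :
  continuous f -> nbhs (f x) A -> nbhs x (f @^-1` A).
Proof. by move=> cf; exact: cf. Qed.

Lemma locally_convex_nbhs V (x : V) (A : set V) :
  locally_convex_tvs V -> nbhs x A ->
  exists U, [/\ open U, convex_set U, U x & U `<=` A].
Proof.
move=> [B convB [openB basisB]] /basisB[U [BU Ux] sUA].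
by exists U; split => //; [exact: openB|apply: convB; rewrite inE].
Qed.

(** The preimages under [f] of the convex open sets of [E] form a base of [V]:
    a neighborhood of [x] in [V] is pulled back along [g] to [E], where a convex
    open set fits inside, and [g (f y) = y] brings it back. *)
Lemma locally_convex_retract V E (f : {linear V -> E}) (g : E -> V) :
  continuous f -> continuous g -> cancel f g ->
  locally_convex_tvs E -> locally_convex_tvs V.
Proof.
move=> cf cg fK lcE; have [B convB [openB basisB]] := lcE.
exists [set f @^-1` U | U in B].
  move=> _ /[!inE] -[U BU <-] x y k /[!inE] Ux Uy.
  have := convB U (mem_set BU) (f x) (f y) k (mem_set Ux) (mem_set Uy).
  by rewrite inE /= linearD !linearZ.
split=> [_ [U BU <-]|x A]; first by apply: open_comp => //; exact: openB.
rewrite -[x in nbhs x _]fK => /cg/basisB[U [BU Ufx] sUA].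
exists (f @^-1` U); first by split => //; exists U.
by move=> y Uy; rewrite -[y]fK; exact: sUA.
Qed.

Lemma locally_convex_isomorphic V E : tvs_isomorphic V E ->
  locally_convex_tvs E -> locally_convex_tvs V.
Proof. by move=> [f [g [fK _ cf cg]]]; exact: locally_convex_retract fK. Qed.

Lemma convex_mean (E : lmodType R) (U : set E) (T : eqType) (v : T -> E) (s : seq T) :
  convex_set U -> (0 < size s)%N -> (forall x, x \in s -> U (v x)) ->
  U ((size s)%:R^-1 *: \sum_(x <- s) v x).
Proof.
move=> convU; elim: s => // x s IH _ Uv.
have Uvx : U (v x) by apply: Uv; rewrite mem_head.
have Uvs y : y \in s -> U (v y) by move=> ys; apply: Uv; rewrite in_cons ys orbT.
have [s0|s0] := posnP (size s).
  by rewrite (size0nil s0) big_seq1 invr1 scale1r.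
(* The mean of [x :: s] is the convex combination, with weight 1 / (size s + 1),
   of [v x] and the mean of [s]. *)
have k0 : (0 : R) <= (size s).+1%:R^-1 by rewrite invr_ge0.
have k1 : (size s).+1%:R^-1 <= (1 : R) by rewrite invf_le1// ler1n.
have := convU (v x) _ (Itv01 k0 k1) (mem_set Uvx) (mem_set (IH s0 Uvs)).
rewrite inE /=; congr U; rewrite big_cons scalerDr; congr (_ + _).
rewrite scalerA; congr (_ *: _).
have n0 : (size s)%:R != 0 :> R by rewrite pnatr_eq0 -lt0n.
have n1 : (size s).+1%:R != 0 :> R by rewrite pnatr_eq0.
apply: (mulfI n1); rewrite mulrA mulrBr mulr1 !mulfV//.
by rewrite -natr1 addrK mulfV.
Qed.

(** A compact set is bounded, here in the form used for images of compact sets. *)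
Lemma compact_absorbed (X : topologicalType) V (K : set X) (i : X -> V) (U : set V) :
  compact K -> continuous i -> nbhs 0 U ->
  exists2 t : R, 0 < t & forall x, K x -> U (t *: i x).
Proof.
move=> /compact_near_coveringP Kco ci U0.
have : \forall t \near (0 : R), K `<=` (fun x => U (t *: i x)).
  apply: (Kco R (nbhs (0 : R)) (fun t x => U (t *: i x))) => x Kx.
  have : nbhs (0 *: i x) U by rewrite scale0r.
  move=> /nbhs_scale[e e0 [B Bix sU]].
  exists (i @^-1` B, ball 0 e) => /=.
    by split; [exact: ci|exact: nbhsx_ballx].
  move=> [y t] [/= By]; rewrite -ball_normE/= distrC => t0.
  exact: sU.
move=> /nbhs_ballP[e /= e0 near0]; exists (e / 2); first by rewrite divr_gt0.
apply: near0; rewrite -ball_normE/= sub0r normrN gtr0_norm ?divr_gt0//.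
by rewrite gtr_pMr// invf_lt1// ltr1n.
Qed.

(** Uniqueness in the universal property, applied to [i] itself. *)
Lemma free_endo_id (X : topologicalType) V (i : X -> V) (G : {linear V -> V}) :
  is_free_tvs i -> continuous G -> (forall x, G (i x) = i x) -> forall v, G v = v.
Proof.
move=> [hV ci univ] cG Gi v; have [idV [_ _ idP]] := univ _ _ hV ci.
rewrite (idP G cG); last by apply/funext => x; rewrite -[RHS]/(G (i x)) Gi.
by rewrite -(idP idfun)// => x; exact: cvg_id.
Qed.

Lemma discrete_continuous (X Y : topologicalType) (f : X -> Y) :
  discrete_space X -> continuous f.
Proof. by move=> dX; apply/continuousP => A _; exact: dX. Qed.

End Tvs.

(** * The free space over a countable discrete space *)

Section FinestLocallyConvex.
Context {R : realType}.

Lemma halving_neighborhoods (V : topologicalLmodType R) (A : set V) : nbhs 0 A ->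
  exists W : nat -> set V, [/\ W 0%N = A, forall n, nbhs 0 (W n) &
    forall n b c, W n.+1 b -> W n.+1 c -> W n (b + c)].
Proof.
move=> A0; have halve B : exists C : set V, nbhs 0 B ->
    nbhs 0 C /\ forall b c, C b -> C c -> B (b + c).
  have [|nB] := pselect (nbhs 0 B); last by exists B.
  rewrite -[in X in X -> _](addr0 (0 : V)) => /nbhs_add[C [D [C0 D0 sB]]].
  exists (C `&` D) => _; split; first exact: filterI.
  by move=> b c [Cb _] [_ Dc]; exact: sB.
have [h hP] := choice halve.
have W0 n : nbhs 0 (iter n h A) by elim: n => //= n /hP[].
exists (fun n => iter n h A); split=> // n b c.
by have [_] := hP _ (W0 n); apply.
Qed.

(** Adding [v m], which lies in [W m.+1], to a tail sum, which does too by
    induction, lands in [W m]: finite sums of any length stay in [W m]. *)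
Lemma sum_halving (V : topologicalLmodType R) (W : nat -> set V) (v : nat -> V) :
  (forall n, nbhs 0 (W n)) ->
  (forall n b c, W n.+1 b -> W n.+1 c -> W n (b + c)) ->
  (forall n, W n.+1 (v n)) ->
  forall k m, W m (\sum_(m <= j < m + k) v j).
Proof.
move=> W0 WD Wv; elim=> [|k IH] m.
  by rewrite addn0 big_geq//; exact: nbhs_singleton.
by rewrite addnS big_ltn ?ltnS ?leq_addr//; apply: WD => //; rewrite -addSn.
Qed.

Lemma sum_fibers (V : zmodType) (X : eqType) (n : X -> nat) (s : seq X) (F : X -> V) N :
  (forall x, x \in s -> (n x < N)%N) ->
  \sum_(x <- s) F x = \sum_(0 <= j < N) \sum_(x <- s | n x == j) F x.
Proof.
move=> nN; rewrite (exchange_big_dep xpredT)//= [LHS]big_seq [RHS]big_seq.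
apply: eq_bigr => x xs.
by under eq_bigl do rewrite eq_sym; rewrite big_nat1_eq nN.
Qed.

(** Number the points of [X] by [n] and shrink a neighborhood [A] of 0 to a
    sequence [W] with [W k.+1 + W k.+1 `<=` W k]. If the coefficient at [x] is
    smaller than some [d x > 0], its term lies in [W (n x).+1], and any finite sum
    of such terms lies in [A]. The weight [1 / d x] enforces that smallness.
    Countability is what lets all the points share one sequence [W]. *)
Lemma lin_ext_l1_continuous (X : choiceType) (V : topologicalLmodType R) (g : X -> V) :
  countable [set: X] ->
  continuous (lin_ext g : Fspace (l1_system R X) -> V).
Proof.
move=> /countable_injP[n n_inj].
pose L : {linear Fspace (l1_system R X) -> V} := lin_ext g.
apply: (@linear_continuous_at0 _ _ _ L) => A /halving_neighborhoods[W [WA W0 WD]].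
have small x : exists d : R, 0 < d /\ forall t, `|t| < d -> W (n x).+1 (t *: g x).
  have : nbhs (0 *: g x) (W (n x).+1) by rewrite scale0r.
  move=> /nbhs_scale[d d0 [B Bx sW]]; exists d; split => // t td.
  by apply: sW; [rewrite subr0|exact: nbhs_singleton].
have [d dP] := choice small.
exists (wnorm idfun (fun x => (d x)^-1)), 1.
  split=> //; exists (fun x => (d x)^-1) => //= x.
  by rewrite invr_ge0 ltW//; case: (dP x).
move=> f; rewrite /Fball/= subr0 => f1.
have fd x : `|f x : R| < d x.
  have [dx0 _] := dP x.
  rewrite -[d x]mulr1 -ltr_pdivrMl//; apply: le_lt_trans f1.
  apply: (@wnorm_ge R X idfun erefl (fun _ r0 => r0) (fun x => (d x)^-1) f x) => y.
  by rewrite invr_ge0 ltW//; case: (dP y).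
have [S fS] := formal_supp f.
rewrite /L /= (lin_ext_fset g fS).
rewrite (@sum_fibers _ _ n _ _ (\max_(x <- S) n x).+1); last first.
  by move=> x xS; rewrite ltnS; exact: leq_bigmax_seq.
rewrite -WA -[X in \sum_(_ <= _ < X) _]add0n; apply: sum_halving => // j.
have [/hasP[x xS /eqP nx]|/hasPn noj] := boolP (has (fun x => n x == j) S).
  rewrite big_mkcond (bigD1_seq x)//= nx eqxx big1 => [|y yx].
    by rewrite addr0 -nx; have [_] := dP x; apply.
  case: eqP => // ny; case/eqP: yx; apply: n_inj; rewrite ?inE//.
  by rewrite ny nx.
rewrite big_seq_cond big_pred0 => [|x]; first exact: nbhs_singleton.
by apply/negbTE/negP => /andP[/noj/negbTE ->].
Qed.

Lemma free_discrete_countable_locally_convex (X : topologicalType)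
    (V : topologicalLmodType R) (i : X -> V) :
  is_free_tvs i -> discrete_space X -> countable [set: X] -> locally_convex_tvs V.
Proof.
move=> freeV dX cX; have [hV ci univ] := freeV.
have cdelta : continuous (@delta R X : X -> Fspace (l1_system R X)).
  exact: discrete_continuous.
have [F [cF iF _]] := univ _ _ (@l1_hausdorff R X) cdelta.
pose L : {linear Fspace (l1_system R X) -> V} := lin_ext i.
have cL : continuous L := lin_ext_l1_continuous cX.
apply: (locally_convex_retract cF cL _ (@l1_locally_convex R X)).
apply: (free_endo_id (G := L \o F) freeV) => [v|x].
  by apply: continuous_comp; [exact: cF|exact: cL].
by rewrite /= -[F (i x)]/((F \o i) x) -iF /L /= lin_ext_delta.
Qed.

End FinestLocallyConvex.

(** * Convex sets and the square-root F-norm *)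

Section RootTarget.
Context {R : realType}.

Definition root_norm (T : choiceType) : formal R T -> R :=
  wnorm Num.sqrt (cst 1).

Lemma root_norm_lt1_nbhs (T : choiceType) (V : topologicalLmodType R)
    (F : {linear V -> Fspace (root_system R T)}) : continuous F ->
  nbhs 0 [set v | root_norm (F v) < 1].
Proof.
move=> cF; have B0 : nbhs (F 0) (Fball (E := formal R T) (@root_norm T) 1 (F 0)).
  apply: (@nbhs_Fball R (formal R T) (root_system R T) (@root_norm T)) => //.
  by exists (cst 1).
apply: filterS (continuous_preimage cF B0) => v; rewrite /Fball /=.
by rewrite linear0 subr0.
Qed.

(** The mean of the [v x] lies in [U] and is mapped to a vector with [n] entries
    of modulus at least [r / n], so [n * sqrt (r / n) = sqrt (n * r) < 1]. *)
Lemma convex_root_norm_bound (T : choiceType) (V : lmodType R)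
    (F : {linear V -> Fspace (root_system R T)}) (U : set V)
    (s : seq T) (v : T -> V) (a : T -> R) (r : R) :
  convex_set U -> (forall v, U v -> root_norm (F v) < 1) ->
  uniq s -> 0 <= r ->
  (forall x, x \in s -> [/\ U (v x), F (v x) = a x *: delta R x & r <= `|a x|]) ->
  (size s)%:R * r < 1.
Proof.
move=> convU sU us r0 sP; have [s0|s0] := posnP (size s); first by rewrite s0 mul0r.
have Uv x : x \in s -> U (v x) by move=> /sP[].
have /sU := convex_mean convU s0 Uv.
set f := F _; set n : R := (size s)%:R.
have n0 : 0 < n by rewrite ltr0n.
have fE y : y \in s -> (f : formal R T) y = n^-1 * a y.
  move=> ys; rewrite /f linearZ linear_sum formalZE formal_sumE; congr (_ * _).
  rewrite (bigD1_seq y)//= big1_seq => [|x /andP[xy xs]].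
    by have [_ -> _] := sP y ys; rewrite formalZE deltaE eqxx mulr1 addr0.
  by have [_ -> _] := sP x xs; rewrite formalZE deltaE eq_sym (negbTE xy) mulr0.
move=> /(le_lt_trans _) lt1.
have : n * Num.sqrt (r / n) < 1.
  apply: lt1; apply: le_trans (@wnorm_ge_sum R T Num.sqrt _ _ (cst 1) f s _ us) => //.
  - rewrite /n mulr_natl -iter_addr_0 -count_predT -big_const_seq.
    rewrite big_seq [leRHS]big_seq; apply: ler_sum => x xs; rewrite /= mul1r.
    apply: ler_wsqrtr; rewrite fE// normrM [r / n]mulrC gtr0_norm ?invr_gt0//.
    by rewrite ler_pM2l ?invr_gt0//; case: (sP x xs).
  - exact: sqrtr0.
rewrite -[X in X * Num.sqrt _ < _](gtr0_norm n0) -sqrtr_sqr -sqrtrM ?sqr_ge0//.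
rewrite -[X in _ < X](sqrtr1 R) ltr_sqrt//.
by rewrite expr2 -mulrA [n * (r / n)]mulrC divfK ?gt_eqF.
Qed.

(** A convex neighborhood [U] of 0 is absorbing, so [X] is the union of the sets
    [A k] of points [x] with [i x / (k + 1)] in [U]. The bound on means leaves at
    most [k] points in [A k]. *)
Lemma discrete_locally_convex_countable (X : topologicalType)
    (V : topologicalLmodType R) (i : X -> V) :
  is_free_tvs i -> discrete_space X -> locally_convex_tvs V -> countable [set: X].
Proof.
move=> [hV ci univ] dX lcV.
have cdelta : continuous (@delta R X : X -> Fspace (root_system R X)).
  exact: discrete_continuous.
have [F [cF iF _]] := univ _ _ (@root_hausdorff R X) cdelta.
have [U [openU convU U0 sU]] := locally_convex_nbhs lcV (root_norm_lt1_nbhs cF).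
have absU x : exists k : nat, U (k.+1%:R^-1 *: i x).
  have : nbhs (0 *: i x) U by rewrite scale0r; exact: open_nbhs_nbhs.
  move=> /nbhs_scale[e e0 [B Bx sB]].
  exists (Num.truncn e^-1); apply: sB; last exact: nbhs_singleton.
  rewrite subr0 gtr0_norm ?invr_gt0// invf_plt ?posrE//.
  exact: truncnS_gt.
pose A k := [set x | U (k.+1%:R^-1 *: i x)].
have -> : [set: X] = \bigcup_(k in [set: nat]) A k.
  by apply/seteqP; split=> // x _; have [k Uk] := absU x; exists k.
apply: bigcup_countable => // k _; apply: finite_set_countable.
apply: contrapT => /(@infinite_set_fset _ _ k.+1)[S SA kS].
suff : (size S)%:R * k.+1%:R^-1 < 1 :> R.
  by rewrite -ltr_pdivlMr ?invr_gt0// invrK mul1r ltr_nat ltnNge kS.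
apply: (convex_root_norm_bound (v := fun x => k.+1%:R^-1 *: i x)
  (a := fun=> k.+1%:R^-1) convU sU (fset_uniq S)) => [|x xS].
  by rewrite invr_ge0.
split; [exact: SA| |exact: ler_norm].
by rewrite linearZ -[F (i x)]/((F \o i) x) -iF.
Qed.

End RootTarget.

(** * Compact subsets *)

Section DisjointBumps.
Context {R : realType} {X : topologicalType}.

Lemma tychonoff_separation (a b : X) : tychonoff_space X -> a != b ->
  exists f : X -> R, [/\ continuous f, f a = 0 & f b = 1].
Proof.
move=> [hX crX] ab; have clb : closed [set b].
  exact/accessible_closed_set1/hausdorff_accessible.
have nba : ~ [set b] a by move=> /= abE; rewrite abE eqxx in ab.
have /(@uniform_separatorP X R)[f [cf _ fa fb]] := crX a _ clb nba.
by exists f; split => //; [apply: fa; exists a|apply: fb; exists b].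
Qed.

(** Separate two points [a] and [b] of [A] by a function [f]. One of the sets
    [f >= 1/2] and [f < 1/2] meets [A] in infinitely many points; the point on the
    other side is chosen, with a threshold between its value and 1/2. *)
Lemma split_infinite (A : set X) : tychonoff_space X -> infinite_set A ->
  exists2 p : X * (X -> R), A p.1 /\ continuous p.2 &
    0 < p.2 p.1 /\ infinite_set (A `&` [set z | p.2 z < 0]).
Proof.
move=> tX infA.
have [a Aa] : A !=set0.
  by apply/set0P; apply: contra_notN infA => /eqP ->; exact: finite_set0.
have [b [Ab ab]] : (A `\ a) !=set0.
  apply/set0P/negP => /eqP A0; apply: infA.
  by apply: (@sub_finite_set _ _ [set a]) => // z Az; apply: contrapT => za;
    have : (A `\ a) z by []; rewrite A0.
have [|f [cf fa fb]] := tychonoff_separation (a := a) (b := b) tX.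
  by apply/eqP => abE; apply: ab.
have [fin|inf] := pselect (finite_set (A `&` [set z | 1 / 2 <= f z])).
  exists (b, fun z => f z - 2 / 3) => /=.
    by split=> // z; apply: cvgB; [exact: cf|exact: cvg_cst].
  split; first by rewrite fb; lra.
  apply: contra_not infA => finB.
  apply: (sub_finite_set _ (_ : finite_set ((A `&` [set z | 1 / 2 <= f z]) `|`
    (A `&` [set z | f z - 2 / 3 < 0])))); last by rewrite finite_setU.
  move=> z Az; have [h|h] := leP (1 / 2) (f z); first by left.
  by right; split => //=; lra.
exists (a, fun z => 1 / 3 - f z) => /=.
  by split=> // z; apply: cvgB; [exact: cvg_cst|exact: cf].
split; first by rewrite fa; lra.
apply: contra_not inf; apply: sub_finite_set => z [Az /= h]; split => //=; lra.
Qed.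

(** Iterating [split_infinite], the part of the infinite set where [g m] is
    negative is kept after step [m]. So the functions [g n] satisfy
    [g n (y n) > 0] and [g m (y n) < 0] for [m < n]. The product [u n] of the
    positive part of [g n] with the negative parts of the earlier [g m] is then
    positive at [y n], and the supports of the [u n] are disjoint. *)
Lemma disjoint_bumps (K : set X) : tychonoff_space X -> infinite_set K ->
  exists (y : nat -> X) (h : nat -> X -> R),
    [/\ forall n, K (y n), forall n, continuous (h n),
        forall n z, 0 <= h n z <= 1, forall n, h n (y n) = 1 &
        forall m n z, h m z != 0 -> h n z != 0 -> m = n].
Proof.
move=> tX infK.
have [x0 _] : K !=set0.
  by apply/set0P; apply: contra_notN infK => /eqP ->; exact: finite_set0.
have step (A : set X) : exists p : X * (X -> R), infinite_set A ->
    [/\ A p.1, continuous p.2, 0 < p.2 p.1 &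
      infinite_set (A `&` [set z | p.2 z < 0])].
  have [infA|nA] := pselect (infinite_set A); last by exists (x0, fun=> 0).
  by have [p [? ?] [? ?]] := split_infinite tX infA; exists p.
have [c cP] := choice step.
pose next A := A `&` [set z | (c A).2 z < 0].
pose A n := iter n next K.
have infA n : infinite_set (A n) by elim: n => //= n /cP[].
pose g n := (c (A n)).2; pose y n := (c (A n)).1.
have Ay n : A n (y n) by have [] := cP _ (infA n).
have cg n : continuous (g n) by have [] := cP _ (infA n).
have gy n : 0 < g n (y n) by have [] := cP _ (infA n).
have AS n z : A n.+1 z -> A n z /\ g n z < 0 by move=> [].
have AK n z : A n z -> K z by elim: n => // n IH /AS[/IH].
have Ag n m z : (m < n)%N -> A n z -> g m z < 0.
  elim: n => // n IH; rewrite ltnS leq_eqVlt => /predU1P[->/AS[]//|mn /AS[Az _]].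
  exact: IH.
pose u n z := Num.max 0 (g n z) * \prod_(m < n) Num.max 0 (- g m z).
have max0_ge0 (r : R) : 0 <= Num.max 0 r by rewrite le_max lexx.
have max0_neq0 (r : R) : Num.max 0 r != 0 -> 0 < r.
  by apply: contraNT; rewrite -leNgt => r0; rewrite max_l.
have u_ge0 n z : 0 <= u n z by rewrite mulr_ge0// prodr_ge0.
have u_gt0 n : 0 < u n (y n).
  rewrite mulr_gt0 ?prodr_gt0 ?lt_max ?gy ?orbT// => m _.
  by rewrite lt_max oppr_gt0 (Ag n)// orbT.
have u_pos n z : u n z != 0 -> 0 < g n z.
  by rewrite mulf_eq0 negb_or => /andP[/max0_neq0].
have u_neg n m z : (m < n)%N -> u n z != 0 -> g m z < 0.
  move=> mn; rewrite mulf_eq0 negb_or => /andP[_ /prodf_neq0].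
  by move=> /(_ (Ordinal mn) isT) /max0_neq0; rewrite oppr_gt0.
have cmax (f : X -> R) : continuous f -> continuous (fun z => Num.max 0 (f z)).
  move=> cf z; apply: (@continuous_max R X (fun=> 0) f z); last exact: cf.
  exact: cvg_cst.
have cu n : continuous (u n).
  move=> z; apply: cvgM; first exact: (cmax _ (cg n)).
  apply: cvg_big => [|m _]; first exact: mul_continuous.
  by apply: (cmax (fun z => - g m z)) => t; apply: cvgN; exact: cg.
exists y, (fun n z => Num.min 1 (u n z / u n (y n))); split.
- by move=> n; exact: AK (Ay n).
- move=> n z.
  apply: (@continuous_min R X (fun=> 1) (fun z => u n z / u n (y n)) z).
    exact: cvg_cst.
  by apply: cvgM; [exact: cu|exact: cvg_cst].
- by move=> n z; rewrite le_min ler01 divr_ge0//= ge_min lexx.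
- by move=> n; rewrite divff ?gt_eqF// minxx.
- have h_neq0 n z : Num.min 1 (u n z / u n (y n)) != 0 -> u n z != 0.
    by apply: contraNN => /eqP ->; rewrite mul0r min_r.
  move=> m n z /h_neq0 um /h_neq0 un.
  have [mn|nm|//] := ltngtP m n.
    by have := u_neg _ _ _ mn un; rewrite ltNge ltW// u_pos.
  by have := u_neg _ _ _ nm um; rewrite ltNge ltW// u_pos.
Qed.

End DisjointBumps.

Section BumpMap.
Context {R : realType} {X : topologicalType}.
(** Since the supports of the [h n] are disjoint, the sum of the [c n * h n z]
    times the basis vectors has at most one term, and is thus finitely
    supported. *)
Variables (h : nat -> X -> R) (c : nat -> R).
Hypothesis h_continuous : forall n, continuous (h n).
Hypothesis h_itv : forall n z, 0 <= h n z <= 1.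
Hypothesis h_disjoint : forall m n z, h m z != 0 -> h n z != 0 -> m = n.
Hypothesis c_ge0 : forall n, 0 <= c n.
Hypothesis c_cvg0 : c @ \oo --> 0.

Fact bump_map_fsupported z : (fun n => c n * h n z) \in @fsupported R nat.
Proof.
apply/asboolP; have [[n hn]|h0] := pselect (exists n, h n z != 0).
  exists [fset n]%fset => m; rewrite inE; apply: contraNeq; rewrite mulf_eq0 negb_or.
  by move=> /andP[_ hm]; apply/eqP; exact: h_disjoint hm hn.
exists fset0 => m _; rewrite [h m z](_ : _ = 0) ?mulr0//.
by apply: contrapT => /eqP hm; apply: h0; exists m.
Qed.

Definition bump_map z : Fspace (root_system R nat) := Formal (bump_map_fsupported z).

Lemma bump_map_delta n z : h n z != 0 -> bump_map z = (c n * h n z) *: delta R n.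
Proof.
move=> hn; apply: formalP => m; rewrite formalZE deltaE /=.
have [->|mn] := eqVneq m n; first by rewrite mulr1.
have [->|hm] := eqVneq (h m z) 0; first by rewrite !mulr0.
by rewrite (h_disjoint hm hn) eqxx in mn.
Qed.

Lemma bump_map_eq0 z : (forall n, h n z = 0) -> bump_map z = 0.
Proof. by move=> h0; apply: formalP => n /=; rewrite h0 mulr0. Qed.

Let root_norm_delta (t : R) n :
  wnorm Num.sqrt (cst 1) (t *: delta R n : formal R nat) = Num.sqrt `|t|.
Proof. by rewrite wnorm_delta ?mul1r// sqrtr0. Qed.

(** Near a point where some [h n] does not vanish, only the [n]-th term occurs.
    Near a point [z] where all vanish, the finitely many terms with [c n] large
    are small by continuity, and the others because [h n <= 1]. *)
Lemma bump_map_continuous : continuous bump_map.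
Proof.
move=> z A [q [e [[w /= -> ->] e0] sA]].
have e20 : 0 < e ^+ 2 by rewrite exprn_gt0.
have sqrt_lt (r : R) : r < e ^+ 2 -> Num.sqrt r < e.
  by move=> re; rewrite -[e]gtr0_norm// -sqrtr_sqr ltr_sqrt.
have cch n : continuous (fun t => c n * h n t).
  by move=> t; apply: cvgM; [exact: cvg_cst|exact: h_continuous].
have [[n hn]|h0] := pselect (exists n, h n z != 0).
  have near_h : \forall t \near z, h n t != 0.
    by apply: (cvgr_neq0 _ (@h_continuous n z)).
  have near_c : \forall t \near z, `|c n * h n z - c n * h n t| < e ^+ 2.
    by have /cvgrPdist_lt := cch n z; apply.
  apply: filterS2 near_h near_c => t ht ct; apply: sA; rewrite /Fball/=.
  rewrite (bump_map_delta hn) (bump_map_delta ht) -scalerBl root_norm_delta.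
  by apply: sqrt_lt; rewrite distrC.
have {}h0 n : h n z = 0 by apply/eqP; apply: contrapT => /negP hn; apply: h0; exists n.
have [N _ cN] : \forall n \near \oo, c n < e ^+ 2.
  by have := cvgr_lt _ c_cvg0; apply.
have near_lt : \forall t \near z, forall n : 'I_N, c n * h n t < e ^+ 2.
  apply: filter_forall => n; have := cvgr_lt _ (cch n z); apply.
  by rewrite h0 mulr0.
apply: filterS near_lt => t lt_t; apply: sA; rewrite /Fball/= (bump_map_eq0 h0) subr0.
have [[n hn]|ht0] := pselect (exists n, h n t != 0); last first.
  rewrite bump_map_eq0 => [|n].
    by rewrite -(scale0r (delta R 0%N)) root_norm_delta normr0 sqrtr0.
  by apply/eqP; apply: contrapT => /negP hn; apply: ht0; exists n.
have /andP[h0t h1t] := h_itv n t.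
rewrite (bump_map_delta hn) root_norm_delta ger0_norm ?mulr_ge0//; apply: sqrt_lt.
have [nN|Nn] := ltnP n N; first exact: (lt_t (Ordinal nN)).
by apply: le_lt_trans (cN n Nn); rewrite ler_piMr.
Qed.

End BumpMap.

Lemma invsqrt_cvg0 (R : realType) : (Num.sqrt n.+1%:R)^-1 @[n --> \oo] --> (0 : R).
Proof.
rewrite -[X in _ --> X]sqrtr0.
have := cvg_comp _ _ (@cvg_harmonic R) (@sqrt_continuous R 0).
by apply: cvg_trans; apply: near_eq_cvg; near=> n; rewrite /= /harmonic sqrtrV.
Unshelve. all: by end_near. Qed.

(** The coefficients [1 / sqrt (n + 1)] tend to 0, so that the map is continuous,
    but slowly enough for [n * (t / sqrt n) = t * sqrt n] to be unbounded. *)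
Lemma locally_convex_compact_finite (R : realType) (X : topologicalType)
    (V : topologicalLmodType R) (i : X -> V) (K : set X) :
  tychonoff_space X -> is_free_tvs i -> locally_convex_tvs V ->
  compact K -> finite_set K.
Proof.
move=> tX [hV ci univ] lcV cptK; apply: contrapT => infK.
have [y [h [Ky ch h01 hy hdisj]]] := @disjoint_bumps R X K tX infK.
pose c n : R := (Num.sqrt n.+1%:R)^-1.
have c0 n : 0 <= c n by rewrite invr_ge0 sqrtr_ge0.
have [F [cF iF _]] := univ _ _ (@root_hausdorff R nat)
  (bump_map_continuous (h_disjoint := hdisj) ch h01 c0 (@invsqrt_cvg0 R)).
have [U [openU convU U0 sU]] := locally_convex_nbhs lcV (root_norm_lt1_nbhs cF).
have [t t0 Kt] := compact_absorbed cptK ci (open_nbhs_nbhs (conj openU U0)).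
(* The first [m ^ 2] points have coefficients at least [1 / m]. *)
pose m := (Num.truncn t^-1).+1; have mt : t^-1 < m%:R by exact: truncnS_gt.
pose n := (m ^ 2)%N.
have m0 : (0 : R) < m%:R by rewrite ltr0n.
have sqrtn : Num.sqrt n%:R = m%:R :> R by rewrite natrX sqrtr_sqr gtr0_norm.
suff : (size (iota 0 n))%:R * (t / m%:R) < 1.
  rewrite size_iota natrX expr2 -mulrA [X in _ * X]mulrC divfK ?gt_eqF//.
  by rewrite ltNge -ler_pdivrMr// div1r ltW.
apply: (convex_root_norm_bound (v := fun j => t *: i (y j))
  (a := fun j => t * c j) convU sU (iota_uniq 0 n)) => [|j].
  by rewrite divr_ge0// ltW.
rewrite mem_iota add0n /= => jn; split.
- by apply: Kt.
- have hj : h j (y j) != 0 by rewrite hy oner_neq0.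
  rewrite linearZ -[F (i _)]/((F \o i) _) -iF (bump_map_delta c hdisj hj) hy mulr1.
  exact: scalerA.
- rewrite /= ger0_norm; last by rewrite mulr_ge0// ltW.
  rewrite ler_pM2l// lef_pV2 ?posrE ?sqrtr_gt0//.
  by rewrite -sqrtn ler_wsqrtr// ler_nat.
Qed.

Lemma finite_closed (X : topologicalType) (A : set X) :
  hausdorff_space X -> finite_set A -> closed A.
Proof. by move=> /hausdorff_accessible/accessible_finite_set_closed; exact. Qed.

Lemma k_space_finite_compacts_discrete (X : topologicalType) :
  hausdorff_space X -> k_space X -> (forall K : set X, compact K -> finite_set K) ->
  discrete_space X.
Proof.
move=> hX kX finX A; rewrite -[A]setCK openC.
have clB (B : set X) :
    (forall K : set X, compact K -> closed (B `&` K)) -> closed B.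
  move=> clK; apply: kX => K cK; exact: (@closed_subspaceW X K _ (clK K cK)).
apply: clB => K /finX finK; apply: finite_closed => //.
exact: finite_setIr.
Qed.

Lemma locally_convex_discrete_countable (R : realType) (X : topologicalType)
    (V : topologicalLmodType R) (i : X -> V) :
  tychonoff_space X -> k_space X -> is_free_tvs i -> locally_convex_tvs V ->
  discrete_space X /\ countable [set: X].
Proof.
move=> tX kX freeV lcV; have dX : discrete_space X.
  apply: k_space_finite_compacts_discrete => //; first by case: tX.
  by move=> K; exact: locally_convex_compact_finite freeV lcV.
by split=> //; exact: discrete_locally_convex_countable freeV dX lcV.
Qed.

(** * The models of the free space *)

Lemma tvs_isomorphic_refl (R : realType) (E : topologicalLmodType R) :
  tvs_isomorphic E E.
Proof. by exists idfun, idfun; split=> // x; exact: cvg_id. Qed.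

Lemma discrete_nat : discrete_space nat.
Proof. by move=> A; exact: discrete_open. Qed.

Section EqualsPhiRn.
Context {R : realType} {X : topologicalType} {V : topologicalLmodType R}.
Context {i : X -> V}.
Hypothesis freeV : is_free_tvs i.
Hypothesis discreteX : discrete_space X.

(** The space [V] is itself a free space over [nat], along a bijection. *)
Lemma free_infinite_equals_phi :
  countable [set: X] -> infinite_set [set: X] -> equals_phi V.
Proof.
move=> cX iX; have /card_set_bijP[f [_ f_inj f_surj]] := eq_card_nat cX iX.
have /choice[k fk] n : exists x, f x = n by have [x _ <-] := f_surj n I; exists x.
have kf x : k (f x) = x by apply: f_inj; rewrite ?inE// fk.
exists V, (i \o k); split; last exact: tvs_isomorphic_refl.
have [hV _ univ] := freeV; split => // [|E g hE cg].
  exact: discrete_continuous discrete_nat.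
have [F [cF gF uniqF]] := univ E (g \o f) hE (discrete_continuous discreteX).
exists F; split => // [|G cG gG].
  by apply/funext => n; have := congr1 (@^~ (k n)) gF; rewrite /= fk.
by apply: uniqF => //; apply/funext => x; rewrite gG /= kf.
Qed.

Lemma rV_linear_continuous n (E : topologicalLmodType R) (v : 'I_n -> E) :
  continuous (fun r : 'rV[R]_n => \sum_(j < n) r ord0 j *: v j).
Proof.
apply: continuous_big => [|j _ r]; first exact: add_continuous.
apply: (@continuous_comp 'rV[R]_n (R^o * E)%type E
  (fun r => (r ord0 j, v j)) (fun z => z.1 *: z.2)); last exact: scale_continuous.
apply: (@cvg_pair _ _ _ (nbhs r) (nbhs (r ord0 j : R^o)) (nbhs (v j))).
  exact: coord_continuous.
exact: cvg_cst.
Qed.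

(** The points of [X] correspond to the standard basis of [R^n], and linear maps out
    of [R^n] are continuous; the two extensions are inverse to each other because
    they are so on the points of [X] and on the basis. *)
Lemma free_finite_equals_Rn : finite_set [set: X] -> exists n, equals_Rn V n.
Proof.
move=> /finite_seqP[s0 s0T]; pose s := undup s0; pose n := size s.
have xs x : x \in s by rewrite mem_undup; have : [set: X] x by []; rewrite s0T.
have idx x : (index x s < n)%N by rewrite index_mem.
pose e x : 'rV[R]_n := delta_mx 0 (Ordinal (idx x)).
pose x_ (j : 'I_n) : X := tnth (in_tuple s) j.
have x_K x : x_ (Ordinal (idx x)) = x by rewrite /x_ (tnth_nth x) nth_index.
have e_x j : e (x_ j) = delta_mx 0 j.
  congr delta_mx; apply: val_inj => /=.
  by rewrite /x_ (tnth_nth (x_ j)) index_uniq ?undup_uniq.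
have [hV ci univ] := freeV; exists n.
have hRn : hausdorff_space 'rV[R]_n by exact: norm_hausdorff.
have [F [cF eF _]] := univ _ e hRn (discrete_continuous discreteX).
pose G0 (r : 'rV[R]_n) : V := \sum_(j < n) r ord0 j *: i (x_ j).
have G0_linear : linear G0.
  move=> t r r'; rewrite /G0 scaler_sumr -big_split; apply: eq_bigr => j _ /=.
  by rewrite !mxE scalerDl scalerA.
pose G : {linear 'rV[R]_n -> V} :=
  HB.pack G0 (GRing.isLinear.Build R _ V *:%R G0 G0_linear).
have cG : continuous G by exact: rV_linear_continuous.
have FE x : F (i x) = e x by rewrite eF.
have Ge x : G (e x) = i x.
  rewrite /G /= /G0 (bigD1 (Ordinal (idx x)))//= big1 => [|j jx].
    by rewrite mxE !eqxx scale1r addr0 x_K.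
  by rewrite mxE (negbTE jx) andbF scale0r.
exists F, G; split => //.
- apply: (free_endo_id (G := G \o F) freeV) => [v|x].
    by apply: continuous_comp; [exact: cF|exact: cG].
  by rewrite -[LHS]/(G (F (i x))) FE Ge.
- move=> r; rewrite /G /= /G0 linear_sum [RHS]row_sum_delta; apply: eq_bigr => j _.
  by rewrite linearZ FE e_x.
Qed.

End EqualsPhiRn.

(** Whatever model of the free space over [nat] is used, it is locally convex by the
    result on countable discrete spaces. *)
Lemma equals_phi_or_Rn_locally_convex (R : realType) (V : topologicalLmodType R) :
  equals_phi V \/ (exists n, equals_Rn V n) -> locally_convex_tvs V.
Proof.
move=> [[Phi [j [freeP isoV]]]|[n isoV]]; apply: locally_convex_isomorphic isoV _.
  exact: free_discrete_countable_locally_convex freeP discrete_nat (countableP _).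
exact: locally_convex.
Qed.

Theorem theorem4p17 (R : realType) (X : topologicalType)
    (V : topologicalLmodType R) (i : X -> V)
    (tychonoffX : tychonoff_space X) (kX : k_space X)
    (freeV : is_free_tvs i) :
  (locally_convex_tvs V <-> discrete_space X /\ countable [set: X]) /\
  (discrete_space X /\ countable [set: X] <->
     equals_phi V \/ exists n : nat, equals_Rn V n).
Proof.
split; split.
- exact: locally_convex_discrete_countable freeV.
- by move=> [dX cX]; exact: free_discrete_countable_locally_convex freeV dX cX.
- move=> [dX cX]; have [fX|iX] := pselect (finite_set [set: X]).
    by right; exact: free_finite_equals_Rn freeV dX fX.
  by left; exact: free_infinite_equals_phi freeV dX cX iX.
- move=> /equals_phi_or_Rn_locally_convex.
  exact: locally_convex_discrete_countable freeV.
Qed.
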